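(* Let $S>1$ be an integer. There exist a preference profile $P$ (on some finite set of candidates) and a collection $\mathcal{B}$ of identical ballots, each ranking all of the candidates, such that, under the single transferable vote (STV) method: (1) the candidates in $W(P,S)$ are exactly the candidates ranked in the top $S$ positions on the ballots in $\mathcal{B}$; (2) when the ballots in $\mathcal{B}$ are added to the ballots in $P$, creating the preference profile $P'$, then $|W(P,S)\cap W(P',S)|=1$ and none of the top $S-1$ ranked candidates on the ballots in $\mathcal{B}$ is in $W(P',S)$; (3) if a candidate $C$ is ranked in one of the bottom $S-1$ positions on the ballots in $\mathcal{B}$, then $C\in W(P',S)$.
   Context: Ballots and profiles: there are $n$ candidates and $S\ge 1$ seats to fill. A ballot is a strict preference ranking of some (not necessarily all) of the candidates; partial rankings are allowed. A preference profile $P$ is a finite collection (multiset) of ballots, one per voter. An election is a pair $(P,S)$. Adding ballots to $P$ changes neither the set of candidates nor $S$; the quota is recomputed for the new number of voters. STV (standard Scottish rules): the method takes $(P,S)$ and outputs a set $W(P,S)$ of $S$ winners. The quota is $$q=\left\lfloor \frac{\text{number of voters}}{S+1}\right\rfloor+1$$ and is fixed throughout the count. Initially each ballot has weight $1$ and is held by its first-ranked candidate. In any round, a candidate's (first-place) vote total is the total weight of the ballots that candidate currently holds. The count proceeds in rounds: (i) Any candidate, not elected or eliminated, whose vote total is at least $q$ is elected. Surplus votes of elected candidates are transferred: if $X$ is elected with vote total $v\ge q$, then $X$ retains $q$ votes, and each ballot held by $X$ is passed on, with its weight multiplied by $(v-q)/v$, to the next candidate on that ballot who is neither elected nor eliminated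 (if there is none, that weight is no longer held by any candidate in the count). If several elected candidates have untransferred surpluses, these are transferred one at a time, the largest vote total first; candidates who have already reached quota receive no transfers. (ii) If no candidate newly achieves quota and no surplus remains to be transferred, the non-elected, non-eliminated candidate with the fewest votes is eliminated, and each ballot held by that candidate is passed on, at its current weight, to the next candidate on that ballot who is neither elected nor eliminated (if there is none, the ballot is exhausted). The process stops when $S$ candidates have been elected, or when some number $S'<S$ of candidates have been elected by reaching quota and only $S-S'$ candidates remain who are neither elected nor eliminated; in the latter case these remaining candidates are also elected. Ties: the issue of ties is avoided; that is, $(P,S)$ and $(P',S)$ are to be elections whose winner set does not depend on how ties are broken, so that $W(P,S)$ and $W(P',S)$ are well defined. *)

(* Defs.v *)
(* Mathematical Components world. *)
From HB Require Import structures.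
From mathcomp Require Import all_boot all_order all_algebra.
Set Implicit Arguments.
Unset Strict Implicit.
Unset Printing Implicit Defensive.
Import Order.TTheory GRing.Theory Num.Theory.

Section STV.
Variable C : finType.

(* A ballot lists candidates from most to least preferred. *)
Definition is_ballot (b : seq C) : bool := (b != [::]) && uniq b.

Definition ranks_all (b : seq C) : Prop := uniq b /\ forall c : C, c \in b.

(* One entry per voter; nothing below depends on the order of the entries. *)
Definition profile : Type := seq (seq C).

Definition is_profile (P : profile) : bool := all is_ballot P.

Definition quota (P : profile) (S : nat) : nat := (size P %/ S.+1).+1.

(* An entry [(w, b)] of [piles] is a voter's ballot with current weight [w];
   [b] is what is left of the ranking, its head being the candidate that
   currently holds the ballot ([b] empty: nobody holds it). *)
Record state := State {
  elected : {set C};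
  eliminated : {set C};
  piles : seq (rat * seq C)
}.

Definition hopeful (st : state) : {set C} :=
  ~: (elected st :|: eliminated st).

Definition votes (st : state) (c : C) : rat :=
  (\sum_(wb <- piles st | ohead wb.2 == Some c) wb.1)%R.

Definition reaches_quota (q : nat) (st : state) : {set C} :=
  [set c in hopeful st | (q%:R <= votes st c)%R].

(* Elected candidates receive no ballots, and the ballots of [c] all leave [c]
   when its surplus is transferred (the [q] votes that [c] retains are not
   recorded, since no rule refers to them); hence this is the set of elected
   candidates whose surplus is nonzero and not yet transferred. *)
Definition with_surplus (q : nat) (st : state) : {set C} :=
  [set c in elected st | (q%:R < votes st c)%R].

(* Multiply by [a] the weights of the ballots held by [x] and pass them on to
   the next candidate in [H].  Dropping all candidates outside [H] is harmless
   because [H] is always the set of hopefuls, which only shrinks. *)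
Definition pass_on (H : {set C}) (a : rat) (x : C) (wb : rat * seq C) :
    rat * seq C :=
  if ohead wb.2 == Some x
  then ((wb.1 * a)%R, [seq c <- behead wb.2 | c \in H])
  else wb.

Definition elect_all (q : nat) (st : state) : state :=
  State (elected st :|: reaches_quota q st) (eliminated st) (piles st).

Definition transfer_surplus (q : nat) (st : state) (x : C) : state :=
  let v := votes st x in
  State (elected st) (eliminated st)
    [seq pass_on (hopeful st) ((v - q%:R) / v)%R x wb | wb <- piles st].

Definition eliminate (st : state) (x : C) : state :=
  State (elected st) (x |: eliminated st)
    [seq pass_on (hopeful st :\ x) 1%R x wb | wb <- piles st].

(* Ties, both for the largest surplus and for the fewest votes, make this
   relation nondeterministic. *)
Inductive step (q : nat) (st : state) : state -> Prop :=
| step_elect :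
    reaches_quota q st != set0 ->
    step q st (elect_all q st)
| step_transfer (x : C) :
    reaches_quota q st = set0 ->
    x \in with_surplus q st ->
    (forall y, y \in with_surplus q st -> (votes st y <= votes st x)%R) ->
    step q st (transfer_surplus q st x)
| step_eliminate (x : C) :
    reaches_quota q st = set0 ->
    with_surplus q st = set0 ->
    x \in hopeful st ->
    (forall y, y \in hopeful st -> (votes st x <= votes st y)%R) ->
    step q st (eliminate st x).

Definition stopped (S : nat) (st : state) : bool :=
  (#|elected st| == S) ||
  ((#|elected st| < S) && (#|hopeful st| == S - #|elected st|)).

(* [run q S st W]: from [st], for some way of breaking ties, the count ends
   with winner set [W]. *)
Inductive run (q S : nat) : state -> {set C} -> Prop :=
| run_full (st : state) :
    #|elected st| = S ->
    run q S st (elected st)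
| run_remaining (st : state) :
    #|elected st| < S ->
    #|hopeful st| = S - #|elected st| ->
    run q S st (elected st :|: hopeful st)
| run_step (st st' : state) (W : {set C}) :
    ~~ stopped S st ->
    step q st st' ->
    run q S st' W ->
    run q S st W.

Definition init (P : profile) : state :=
  State set0 set0 [seq (1%R, b) | b <- P].

Definition stv_outcome (P : profile) (S : nat) (W : {set C}) : Prop :=
  run (quota P S) S (init P) W.

(* [W(P, S)] is well defined, i.e. independent of how ties are broken, and
   equal to [W]. *)
Definition stv_winners (P : profile) (S : nat) (W : {set C}) : Prop :=
  stv_outcome P S W /\ forall W' : {set C}, stv_outcome P S W' -> W' = W.

End STV.

(* Main.v *)
(** Put [S = n + 1].  Besides a star [z] and a pivot [d] there are [n]
    candidates [a_i] and [n] candidates [c_i]; the added ballots rank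
    [a_1 > ... > a_n > z > d > c_1 > ... > c_n].  With [c = base n], first-place
    votes are [c + 2] for each [a_i], [c] for each [c_i] and [c - 1] for [d],
    while [z] exceeds the quota by 2 and all its ballots name [d] next.

    Without the added ballots, the surplus of [z] lifts [d] to [c + 1]; so the
    [c_i], whose ballots name nobody else, are eliminated, then [d], and the
    [a_i] win along with [z].  The [k = 2 (S + 1)] added ballots raise the quota
    by 2, so [z] has no surplus, and they stay with [a_1] as long as it is in the
    count.  Then [d] goes first and passes [share n > k + 2] votes to every
    [c_i]; these are now ahead of the [a_i], which are all eliminated. *)
Require Import Defs.
From HB Require Import structures.
From mathcomp Require Import all_boot all_order all_algebra.
From mathcomp Require Import zify ring lra.
Set Implicit Arguments.
Unset Strict Implicit.
Unset Printing Implicit Defensive.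
Import Order.TTheory GRing.Theory Num.Theory.

(** * Counts whose outcome does not depend on ties *)

(** Follows all ways of breaking ties at once: every successor must be decided, and one must exist
    so that a run exists. The only way to stop is with as many hopefuls as open seats, which is how
    both counts below end. *)
Inductive decided (C : finType) (q S : nat) (W : {set C}) (st : state C) :
    Prop :=
| decided_stop :
    #|elected st| < S -> #|hopeful st| = S - #|elected st| ->
    elected st :|: hopeful st = W -> decided q S W st
| decided_step :
    ~~ stopped S st -> (exists st', step q st st') ->
    (forall st', step q st st' -> decided q S W st') -> decided q S W st.

(** A stopped state admits no [run_step] and any other state admits nothing else, so each run
    follows a branch of the derivation. *)
Lemma decided_run (C : finType) (q S : nat) (W : {set C}) (st : state C) :
  decided q S W st ->
  run q S st W /\ forall W', run q S st W' -> W' = W.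
Proof.
elim=> {st} [st ltS cardH <-|st nstop [st0 step0] _ IH].
  split=> [|W' runW']; first exact: run_remaining.
  case: st W' / runW' ltS cardH => [st ->|//|st st' W' nstop _ _ ltS cardH].
    by rewrite ltnn.
  by move: nstop; rewrite /stopped ltS cardH eqxx orbT.
split; first exact: (run_step nstop step0 (IH _ step0).1).
move=> {step0} W' runW'; case: st W' / runW' nstop IH.
- by move=> st cardE; rewrite /stopped cardE eqxx.
- by move=> st ltS cardH; rewrite /stopped ltS cardH eqxx orbT.
- by move=> st st' W' _ step' run' _ IH; apply: (IH _ step').2.
Qed.

(** * Vote totals of piles and their change under transfers *)

Section Tally.
Local Open Scope ring_scope.

(** [votes] as a function of the piles, so that the profile and the added bundle can be tallied
    separately. *)
Definition tally (C : finType) (pl : seq (rat * seq C)) (y : C) : rat :=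
  \sum_(wb <- pl | ohead wb.2 == Some y) wb.1.

Lemma tally_cat (C : finType) (s t : seq (rat * seq C)) (y : C) :
  tally (s ++ t) y = tally s y + tally t y.
Proof. exact: big_cat. Qed.

Lemma tally_nseq (C : finType) (k : nat) (b : seq C) (y : C) :
  tally (nseq k (1, b)) y = (if ohead b == Some y then k else 0%N)%:R.
Proof.
rewrite /tally big_nseq_cond; case: ifP => //= _.
by elim: k => //= k ->; rewrite mulrS.
Qed.

Lemma tally_unweighted (C : finType) (P : profile C) (y : C) :
  tally [seq (1, b) | b <- P] y = (count (fun b => ohead b == Some y) P)%:R.
Proof. by rewrite /tally big_map -sum1_count natr_sum. Qed.

Lemma tally_pass_on (C : finType) (H : {set C}) (a : rat) (x y : C)
    (pl : seq (rat * seq C)) :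
  y != x ->
  tally [seq pass_on H a x wb | wb <- pl] y =
  tally pl y + a * \sum_(wb <- pl | (ohead wb.2 == Some x) &&
    (ohead [seq c <- behead wb.2 | c \in H] == Some y)) wb.1.
Proof.
move=> yx; rewrite /tally big_map.
elim: pl => [|wb pl IH]; first by rewrite !big_nil mulr0 addr0.
rewrite !big_cons IH /pass_on; case: (ohead wb.2 =P Some x) => [->|_] /=.
  have /negPf-> : Some x != Some y by apply: contra yx => /eqP[->].
  by case: ifP => _; ring.
by case: ifP => _; ring.
Qed.

Lemma tally_pass_on_self (C : finType) (H : {set C}) (a : rat) (x : C)
    (pl : seq (rat * seq C)) :
  x \notin H -> tally [seq pass_on H a x wb | wb <- pl] x = 0.
Proof.
move=> xH; rewrite /tally big_map big1 // => wb.
rewrite /pass_on; case: ifP => [_|->//] /=.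
case E: [seq _ <- _ | _] => [//|z s] /= /eqP[zx].
have : z \in [seq c <- behead wb.2 | c \in H] by rewrite E mem_head.
by rewrite mem_filter zx (negPf xH).
Qed.

(** For transfers in which all ballots of [x] share one fate: the surplus of the star, and
    eliminations that exhaust every ballot ([z = None]). *)
Lemma tally_pass_on_uniform (C : finType) (H : {set C}) (a : rat) (x y : C)
    (z : option C) (pl : seq (rat * seq C)) :
  (forall wb, wb \in pl -> ohead wb.2 = Some x ->
     ohead [seq c <- behead wb.2 | c \in H] = z) ->
  y != x ->
  tally [seq pass_on H a x wb | wb <- pl] y =
  tally pl y + (if z == Some y then a * tally pl x else 0).
Proof.
move=> plz yx; rewrite tally_pass_on //; congr (_ + _).
rewrite /tally big_seq_cond; case: ifP => zy; last first.
  rewrite big1 ?mulr0 // => wb /and3P[wbpl /eqP wbx].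
  by rewrite plz // zy.
congr (_ * _); rewrite [RHS]big_seq_cond; apply: eq_bigl => wb.
case: (boolP (wb \in pl)) => //= wbpl.
by case: (ohead wb.2 =P Some x) => //= /plz->.
Qed.

End Tally.

(** * Single steps and the elimination of a whole block *)

Section Steps.
Local Open Scope ring_scope.

Lemma hopeful_eliminate (C : finType) (st : state C) (x : C) :
  hopeful (eliminate st x) = hopeful st :\ x.
Proof.
by apply/setP => y; rewrite !inE orbCA negb_or.
Qed.

Lemma decided_elect (C : finType) (q S : nat) (W : {set C}) (st : state C) :
  ~~ stopped S st -> reaches_quota q st != set0 ->
  decided q S W (elect_all q st) -> decided q S W st.
Proof.
move=> nstop R0 dec; apply: decided_step => //.
  by exists (elect_all q st); apply: step_elect.
move=> st' step'; case: {st'} step' => // [x|x] R0'; by rewrite R0' eqxx in R0.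
Qed.

Lemma decided_transfer (C : finType) (q S : nat) (W : {set C}) (st : state C)
    (x : C) :
  ~~ stopped S st -> reaches_quota q st = set0 ->
  with_surplus q st = [set x] ->
  decided q S W (transfer_surplus q st x) -> decided q S W st.
Proof.
move=> nstop R0 Sx dec; apply: decided_step => //.
  exists (transfer_surplus q st x); apply: step_transfer => //.
    by rewrite Sx set11.
  by move=> y; rewrite Sx inE => /eqP->.
move=> st' step'; case: {st'} step' => [|y _|y _]; first by rewrite R0 eqxx.
  by rewrite Sx inE => /eqP->.
by rewrite Sx => /setP/(_ x); rewrite set11 inE.
Qed.

(** Ties are covered by treating every minimiser; one exists because the hopefuls form a nonempty
    finite set. *)
Lemma decided_eliminate (C : finType) (q S : nat) (W : {set C}) (st : state C) :
  ~~ stopped S st -> reaches_quota q st = set0 -> with_surplus q st = set0 ->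
  hopeful st != set0 ->
  (forall x, x \in hopeful st ->
     (forall y, y \in hopeful st -> votes st x <= votes st y) ->
     decided q S W (eliminate st x)) ->
  decided q S W st.
Proof.
move=> nstop R0 S0 /set0Pn[x0 x0H] dec; apply: decided_step => //.
  case: (arg_minP (votes st) x0H) => x xH xmin.
  by exists (eliminate st x); apply: step_eliminate.
move=> st' step'; case: {st'} step' => [|y _|y _ _]; first by rewrite R0 eqxx.
  by rewrite S0 inE.
exact: dec.
Qed.

(* The [k] copies of [b] are kept apart: wherever they go, they change no vote
   total by more than [k], which is less than the gap between [L] and [K]. *)
Lemma decided_eliminations (C : finType) (q S k : nat) (E K W : {set C})
    (lo : rat) (L : {set C}) (pl : seq (rat * seq C)) (b : seq C)
    (st : state C) :
  (#|E| < S)%N -> (S <= #|E| + #|K|)%N -> [disjoint K & L] ->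
  elected st = E -> hopeful st = K :|: L ->
  piles st = pl ++ nseq k (1, b) ->
  (forall y, y \in E -> ohead b != Some y) ->
  (forall y, y \in E -> tally pl y <= q%:R) ->
  (forall y, y \in K :|: L -> tally pl y + k%:R < q%:R) ->
  (forall y, y \in L -> tally pl y <= lo) ->
  (forall y, y \in K -> lo + k%:R < tally pl y) ->
  (forall wb x, wb \in pl -> x \in L -> ohead wb.2 = Some x ->
     [seq c <- behead wb.2 | c \in K :|: L] = [::]) ->
  (forall pl' b' st', elected st' = E -> hopeful st' = K ->
     piles st' = pl' ++ nseq k (1, b') ->
     (forall y, y \in E -> ohead b' != Some y) ->
     (forall y, y \in E :|: K -> tally pl' y = tally pl y) ->
     (forall wb, wb \in pl' -> wb.2 = [::] \/ wb \in pl) ->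
     decided q S W st') ->
  decided q S W st.
Proof.
move=> ES SEK; move Dl: #|L| => l.
elim: l L Dl pl b st => [|l IH] L Dl pl b st disKL elE hopKL Dpl bE
    tE tq tL tK plL dec.
  move/eqP: Dl; rewrite cards_eq0 => /eqP L0.
  by apply: (dec pl b) => //; [rewrite hopKL L0 setU0 | right].
have disE y : y \in K :|: L -> y \notin E.
  by rewrite -hopKL -elE !inE negb_or => /andP[].
have votesE y : votes st y = tally pl y + tally (nseq k (1, b)) y.
  by rewrite -tally_cat -Dpl.
(* The bundle has at most one holder. *)
have bundle y : 0 <= tally (nseq k (1, b)) y <= k%:R.
  by rewrite tally_nseq ler0n ler_nat; case: ifP; rewrite /= ?leqnn.
have cardKL : #|K :|: L| = (#|K| + l.+1)%N.
  by rewrite -Dl cardsU disjoint_setI0 // cards0 subn0.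
apply: decided_eliminate.
(* While [L] is nonempty, there are more hopefuls than open seats. *)
- by rewrite /stopped elE hopKL cardKL; lia.
- apply/setP => y; rewrite in_set0 inE hopKL; apply/negbTE/negP => /andP[yKL].
  by have := bundle y; have := tq y yKL; rewrite votesE; lra.
- apply/setP => y; rewrite in_set0 inE elE; apply/negbTE/negP => /andP[yE].
  rewrite votesE tally_nseq (negPf (bE y yE)) addr0.
  by have := tE y yE; lra.
- by rewrite hopKL -card_gt0 cardKL addnS.
move=> x; rewrite hopKL => xKL xmin.
(* A member of [K] has more than [lo + k] votes, a member of [L] at most that many even with the
   bundle, so no minimiser lies in [K]. *)
have xL : x \in L.
  have [x1 x1L] : exists x1, x1 \in L by apply/set0Pn; rewrite -card_gt0 Dl.
  have := xKL; rewrite inE => /orP[xK|//].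
  have := xmin x1; rewrite inE x1L orbT => /(_ isT).
  have := tK _ xK; have := tL _ x1L; rewrite !votesE.
  by have := bundle x; have := bundle x1; lra.
have xK : x \notin K by apply: contraTN xL => /(disjointFr disKL)->.
have KLx : (K :|: L) :\ x = K :|: (L :\ x).
  rewrite setDUl; congr (_ :|: _); apply/setDidPl.
  by rewrite disjoint_sym disjoints1.
pose pl' := [seq pass_on ((K :|: L) :\ x) 1 x wb | wb <- pl].
(* The ballots of [pl] held by [x] name no other hopeful, so they are exhausted and no other total
   changes. *)
have pl'E y : y != x -> tally pl' y = tally pl y.
  move=> yx; rewrite (@tally_pass_on_uniform _ _ _ _ _ None) ?addr0 //.
  move=> wb wbpl wbx; have := plL _ _ wbpl xL wbx.
  move/(congr1 (filter (predC1 x))); rewrite -filter_predI /= => nil.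
  rewrite (eq_filter (a2 := predI (predC1 x) (mem (K :|: L)))) ?nil //.
  by move=> c; rewrite /= in_setD1.
have pl'sub wb : wb \in pl' -> wb.2 = [::] \/ wb \in pl.
  case/mapP => wb0 wb0pl ->; rewrite /pass_on.
  case: (ohead wb0.2 =P Some x) => [hd|_]; last by right.
  left=> /=; have := plL _ _ wb0pl xL hd.
  move/(congr1 (filter (predC1 x))); rewrite -filter_predI /= => <-.
  by apply: eq_filter => c; rewrite /= in_setD1.
apply: (IH (L :\ x) _ pl' (pass_on ((K :|: L) :\ x) 1 x (1, b)).2).
- by have := cardsD1 x L; rewrite xL Dl; lia.
- exact: disjointWr (subD1set _ _) disKL.
- exact: elE.
- by rewrite hopeful_eliminate hopKL.
(* Elimination keeps weights, so the copies stay identical and of weight 1, whether or not [x] held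
   them. *)
- rewrite /= Dpl map_cat hopKL; congr (_ ++ _); rewrite map_nseq; congr nseq.
  by rewrite /pass_on; case: ifP; rewrite //= mulr1.
- move=> y yE; rewrite /pass_on; case: ifP => [_|_]; last exact: bE.
  apply/negP; case D: [seq _ <- _ | _] => [//|z s] /= /eqP[zy].
  have : z \in [seq c <- behead b | c \in (K :|: L) :\ x] by rewrite D mem_head.
  rewrite mem_filter in_setD1 zy => /andP[/andP[_ /disE]].
  by rewrite yE.
- move=> y yE; rewrite pl'E ?tE //; apply: contraTneq yE => ->.
  exact: disE.
- by move=> y; rewrite -KLx in_setD1 => /andP[yx yKL]; rewrite pl'E ?tq.
- by move=> y; rewrite in_setD1 => /andP[yx yL]; rewrite pl'E ?tL.
- move=> y yK; rewrite pl'E ?tK //; by apply: contraTneq yK => ->.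
- move=> wb y wbpl' yLx hd; case: (pl'sub _ wbpl') => [nil|wbpl].
    by rewrite nil in hd.
  have yL : y \in L by move: yLx; rewrite in_setD1 => /andP[].
  have := plL _ _ wbpl yL hd.
  move/(congr1 (filter (predC1 x))); rewrite -filter_predI /= => <-.
  by rewrite -KLx; apply: eq_filter => c; rewrite /= in_setD1.
move=> pl2 b2 st2 el2 hop2 Dpl2 b2E tpl2 sub2.
apply: (dec pl2 b2) => //.
  move=> y yEK; rewrite tpl2 // pl'E //; apply: contraTneq yEK => ->.
  by rewrite inE (negPf xK) orbF disE.
by move=> wb /sub2[|/pl'sub]; [left|].
Qed.

End Steps.

(** * The candidates and the ranking on the added ballots *)

(* [(true, Some i)] is [a_i] and [(false, Some i)] is [c_i]. *)
Definition cand (n : nat) : finType := (bool * option 'I_n)%type.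

Definition star (n : nat) : cand n := (true, None).
Definition pivot (n : nat) : cand n := (false, None).
Definition side (n : nat) (t : bool) : {set cand n} :=
  [set (t, Some i) | i : 'I_n].

Lemma mem_side (n : nat) (t : bool) (y : cand n) :
  (y \in side n t) = (y.1 == t) && isSome y.2.
Proof.
apply/imsetP/idP => [[i _ ->] /=|]; first by rewrite eqxx.
by case: y => s [i|] /andP[/eqP /= -> //]; exists i.
Qed.

Lemma card_side (n : nat) (t : bool) : #|side n t| = n.
Proof. by rewrite card_imset ?card_ord // => i j []. Qed.

Definition ranking (n : nat) : seq (cand n) :=
  [seq (true, Some i) | i <- enum 'I_n] ++
  [:: star n, pivot n & [seq (false, Some i) | i <- enum 'I_n]].

Lemma mem_ranking_side (n : nat) (t : bool) (y : cand n) :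
  (y \in [seq (t, Some i) | i <- enum 'I_n]) = (y \in side n t).
Proof.
apply/mapP/imsetP => [[i _ ->]|[i _ ->]]; first by exists i.
by exists i; rewrite ?mem_enum.
Qed.

Lemma ranking_ranks_all (n : nat) : ranks_all (ranking n).
Proof.
have injS t : injective (fun i : 'I_n => (t, Some i) : cand n) by move=> i j [].
split=> [|[[] [i|]]].
- rewrite cat_uniq /= !(map_inj_uniq (injS _)) enum_uniq /=.
  rewrite !inE !mem_ranking_side !mem_side /= !andbT.
  by apply/hasPn => y; rewrite !mem_ranking_side !mem_side; case: y => [[]].
- by rewrite mem_cat mem_ranking_side mem_side.
- by rewrite mem_cat !inE eqxx orbT.
- by rewrite mem_cat !inE (mem_ranking_side false) mem_side !orbT.
- by rewrite mem_cat !inE eqxx !orbT.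
Qed.

(** * The profile, its quota and its first-place votes *)

(** For [k = 2 * n.+2] added ballots this is [k + 3], the least value above [k + 2]. *)
Definition share (n : nat) : nat := 2 * n + 7.
Definition base (n : nat) : nat := n.+1 * (2 * share n).
Lemma base_gt0 (n : nat) : 0 < base n.
Proof. by rewrite muln_gt0 /share addnS. Qed.

(* The ballots [d] alone: they keep the transfer from [d] to the [c_i] small, so
   that these stay below quota. *)
Definition spare (n : nat) : nat := n * share n + (4 * n + 13).
(** The 5 puts this total 2 above the quota, which has 3 in its place. *)
Definition star_votes (n : nat) : nat := (2 * n + 1) * (2 * share n) + 5.

Definition prof (n : nat) : profile (cand n) :=
  nseq (star_votes n) [:: star n; pivot n] ++ nseq (spare n) [:: pivot n] ++
  flatten [seq nseq (share n) [:: pivot n; (false, Some i)] ++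
               nseq (base n) [:: (false, Some i)] ++
               nseq (base n).+2 [:: (true, Some i)] | i <- enum 'I_n].

(** The size, the first-place totals and the transfer from the pivot are all read off from this
    formula by a choice of [p]. *)
Lemma count_prof (n : nat) (p : pred (seq (cand n))) :
  count p (prof n) =
  p [:: star n; pivot n] * star_votes n + p [:: pivot n] * spare n +
  \sum_i (p [:: pivot n; (false, Some i)] * share n +
    p [:: (false, Some i)] * base n + p [:: (true, Some i)] * (base n).+2).
Proof.
rewrite !count_cat !count_nseq count_flatten sumnE -map_comp big_map big_enum.
rewrite addnA; congr (_ + _); apply: eq_bigr => i _ /=.
by rewrite -addnA -!count_nseq -!count_cat.
Qed.

Lemma sum_eq_ord (n : nat) (i : 'I_n) (x : nat) : \sum_j (j == i) * x = x.
Proof.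
rewrite (bigD1 i) //= eqxx mul1n big1 ?addn0 // => j /negPf->.
by rewrite mul0n.
Qed.

Lemma prof_cases (n : nat) (b : seq (cand n)) : b \in prof n ->
  [\/ b = [:: star n; pivot n], b = [:: pivot n] |
      exists i, [\/ b = [:: pivot n; (false, Some i)],
                    b = [:: (false, Some i)] | b = [:: (true, Some i)]]].
Proof.
rewrite !mem_cat !mem_nseq => /or3P[/andP[_ /eqP->]|/andP[_ /eqP->]|].
- by constructor 1.
- by constructor 2.
move=> /flattenP[s /mapP[i _ ->]]; rewrite !mem_cat !mem_nseq => bi.
constructor 3; exists i.
by case/or3P: bi => /andP[_ /eqP->]; [constructor 1|constructor 2|constructor 3].
Qed.

(** An exact multiple of [S + 1 = n.+2], so each further block of [n.+2] ballots raises the quota by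
    exactly 1. *)
Lemma size_prof (n : nat) :
  size (prof n) = ((2 * n + 1) * (2 * share n) + 2) * n.+2.
Proof.
rewrite -[size _]count_predT count_prof /= !mul1n sum_nat_const card_ord.
rewrite /star_votes /spare /base /share; ring.
Qed.

Lemma quota_prof (n k : nat) (b : seq (cand n)) :
  quota (prof n ++ nseq (k * n.+2) b) n.+1 =
  ((2 * n + 1) * (2 * share n) + k).+3.
Proof.
by rewrite /quota size_cat size_nseq size_prof -mulnDl mulnK // addnAC addn2.
Qed.

Definition first_votes (n : nat) (y : cand n) : nat :=
  match y with
  | (true, None) => star_votes n
  | (false, None) => (base n).-1
  | (true, Some _) => (base n).+2
  | (false, Some _) => base n
  end.

Lemma tally_prof (n : nat) (y : cand n) :
  tally [seq (1%R, b) | b <- prof n] y = (first_votes y)%:R%R.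
Proof.
rewrite tally_unweighted count_prof; congr (_%:R)%R.
case: y => [[] [i|]]; rewrite /star /pivot /=.
- under eq_bigr => j _ do
    rewrite add0n (_ : (Some _ == Some _) = (j == i)) //.
  by rewrite sum_eq_ord.
- by rewrite big1 // !addn0 mul1n.
- under eq_bigr => j _ do
    rewrite add0n addn0 (_ : (Some _ == Some _) = (j == i)) //.
  by rewrite sum_eq_ord.
(* The [n] shares and the spare ballots add up to [base n - 1]. *)
by rewrite sum_nat_const card_ord /spare /base /share /=; nia.
Qed.

Lemma prof_is_profile (n : nat) : is_profile (prof n).
Proof.
by apply/allP => b /prof_cases[->|->|[i [] ->]]; rewrite /is_ballot /= ?inE.
Qed.

(** * The opening round and the final state of both counts *)

Section Counts.
Local Open Scope ring_scope.

Definition ones (n : nat) : seq (rat * seq (cand n)) :=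
  [seq (1, b) | b <- prof n].

Definition star_elected (n : nat) (pl : seq (rat * seq (cand n))) :
    state (cand n) :=
  State [set star n] set0 pl.

Lemma hopeful_star_elected (n : nat) (pl : seq (rat * seq (cand n))) :
  hopeful (star_elected pl) = ~: [set star n].
Proof. by rewrite /hopeful setU0. Qed.

Lemma not_star (n : nat) :
  ~: [set star n] = pivot n |: side n true :|: side n false.
Proof.
by apply/setP => -[[] [i|]]; rewrite !(inE, mem_side).
Qed.

Lemma first_votes_le (n : nat) (y : cand n) :
  y != star n -> (first_votes y <= (base n).+2)%N.
Proof. by case: y => [[] [i|]] //= _; lia. Qed.

(** The lower bound on [q] keeps everyone but the star below quota, even a holder of all [k] added
    ballots. *)
Lemma decided_star (n q k : nat) (b : seq (cand n)) (W : {set cand n}) :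
  (0 < n)%N -> ohead b != Some (star n) ->
  ((base n).+2 + k < q <= star_votes n)%N ->
  decided q n.+1 W (star_elected (ones n ++ nseq k (1, b))) ->
  decided q n.+1 W (init (prof n ++ nseq k b)).
Proof.
move=> n0 bstar qlt dec.
have R : reaches_quota q (init (prof n ++ nseq k b)) = [set star n].
  apply/setP => y; rewrite !inE /votes /= map_cat map_nseq.
  rewrite -/(tally _ y) tally_cat tally_prof tally_nseq -natrD ler_nat.
  have [->|ystar] := eqVneq y (star n); first by rewrite (negPf bstar) /=; lia.
  by have := first_votes_le ystar; case: ifP; lia.
apply: decided_elect.
- rewrite /stopped /hopeful /= setU0 setC0 cardsT card_prod card_option card_bool.
  by rewrite cards0 card_ord; lia.
- by rewrite R; apply/set0Pn; exists (star n); rewrite set11.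
by rewrite /elect_all R /= set0U map_cat map_nseq.
Qed.

Lemma star_nonstop (n : nat) (pl : seq (rat * seq (cand n))) :
  (0 < n)%N -> ~~ stopped n.+1 (star_elected pl).
Proof.
move=> n0; rewrite /stopped hopeful_star_elected /= cards1.
by rewrite cardsC1 card_prod card_option card_bool card_ord; lia.
Qed.

Lemma decided_final (n q : nat) (t : bool) (st : state (cand n)) :
  (0 < n)%N -> elected st = [set star n] -> hopeful st = side n t ->
  decided q n.+1 (star n |: side n t) st.
Proof.
move=> n0 el hop; apply: decided_stop; rewrite ?el ?hop // cards1 //.
by rewrite card_side subn1.
Qed.

(** * The count without the added ballots *)

Lemma decided_without (n : nat) : (0 < n)%N ->
  decided (quota (prof n) n.+1) n.+1 (star n |: side n true) (init (prof n)).
Proof.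
move=> n0; have := quota_prof 0 ([::] : seq (cand n)).
rewrite mul0n cats0 addn0 => q_eq.
have [qlt q2] : ((base n).+2 < quota (prof n) n.+1)%N /\
    star_votes n = (quota (prof n) n.+1 + 2)%N.
  by rewrite q_eq /base /star_votes /share; split; nia.
move: (quota _ _) qlt q2 {q_eq} => q qlt q2.
(* An empty bundle of a dummy ballot fits the lemmas shared by both counts. *)
rewrite -[prof n](cats0 (prof n)) -[[::]]/(nseq 0 [::]).
apply: decided_star => //; first by rewrite addn0 qlt q2 leq_addr.
rewrite cats0; set st := star_elected _.
have votesE y : votes st y = (first_votes y)%:R by apply: tally_prof.
have votes_star : votes st (star n) = q%:R + 2 by rewrite votesE /= q2 natrD.
have q0 : 0 < q%:R :> rat by rewrite ltr0n; lia.
apply: (decided_transfer (x := star n)).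
- exact: star_nonstop.
- apply/setP => y; rewrite in_set0 inE hopeful_star_elected votesE !inE ler_nat.
  by apply/negbTE/negP => /andP[/first_votes_le]; lia.
- apply/setP => y; rewrite !inE; have [->|//] := eqVneq y (star n).
  by rewrite votes_star; lra.
rewrite /transfer_surplus votes_star hopeful_star_elected.
set pl := map _ _; rewrite -[State _ _ _]/(star_elected pl).
have tallyS : tally pl (star n) = 0.
  by apply: tally_pass_on_self; rewrite !inE eqxx.
(* The factor [2 / (q + 2)] applied to [q + 2] votes hands exactly 2 to the pivot, which rises to
   [base n + 1]. *)
have tallyE y : y != star n ->
    tally pl y = (first_votes y)%:R + (if y == pivot n then 2 else 0).
  move=> ystar; rewrite (@tally_pass_on_uniform _ _ _ _ _ (Some (pivot n))) //.
    rewrite tally_prof; have -> : (Some (pivot n) == Some y) = (y == pivot n).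
      by rewrite eq_sym.
    congr (_ + _); case: ifP => // _.
    rewrite -[tally _ _]/(votes st _) votes_star addrAC subrr add0r divfK //.
    by rewrite lt0r_neq0 ?addr_gt0.
  move=> wb /mapP[b /prof_cases[->|->|[i [] ->]] ->] //= _.
  by rewrite !inE.
(* The star's ballots now name the pivot alone; all others are untouched. *)
have pl_cases wb : wb \in pl -> wb.2 = [:: pivot n] \/ wb.2 \in prof n.
  case/mapP => wb0 /mapP[b bP ->] ->; rewrite /pass_on /=.
  case: (ohead b =P _) => [|_]; last by right.
  case/prof_cases: bP => [->|->|[i [] ->]] //= _.
  by left; rewrite !inE.
have {}pl_cases wb : wb \in pl -> ohead wb.2 != Some (star n) ->
  wb.2 = [:: pivot n] \/ exists i, [\/ wb.2 = [:: pivot n; (false, Some i)],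
     wb.2 = [:: (false, Some i)] | wb.2 = [:: (true, Some i)]].
  move=> wbpl; case/pl_cases: (wbpl) => [|/prof_cases[->|->|]] //; by [left|right].
(* First block: the [c_i] with [base n] votes, behind the pivot and the [a_i]. *)
apply: (@decided_eliminations _ q n.+1 0 [set star n] (pivot n |: side n true) _
  (base n)%:R (side n false) pl [::]) => //.
- by rewrite cards1.
- by rewrite cards1 cardsU1 mem_side /= card_side.
- rewrite disjoint_subset; apply/subsetP => -[[] [i|]];
    by rewrite !(inE, mem_side).
- by rewrite hopeful_star_elected not_star.
- by rewrite cats0.
- by move=> y; rewrite inE => /eqP->; rewrite tallyS ler0n.
- rewrite -not_star => y; rewrite mulr0n addr0 !inE => ystar.
  rewrite tallyE //; case: ifP => [/eqP->|_].
    by rewrite -natrD ltr_nat /=; lia.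
  by rewrite addr0 ltr_nat; have := first_votes_le ystar; lia.
- case=> [[] [i|]]; rewrite mem_side //= => _.
  by rewrite tallyE //= addr0.
- case=> [[] [i|]]; rewrite mulr0n addr0 !(inE, mem_side) //= => _.
    by rewrite tallyE //= addr0 ltr_nat.
  by rewrite tallyE //= -natrD ltr_nat; lia.
- move=> wb x wbpl; rewrite mem_side => /andP[/eqP xF xS] hd.
  have : ohead wb.2 != Some (star n).
    by rewrite hd; case: x xF xS {hd} => [[] []].
  by case/(pl_cases _ wbpl) => [E|[i [] E]]; rewrite E /= in hd *;
    case: hd xF xS => <-.
move=> pl2 b2 st2 el2 hop2 Dpl2 _ tally2 sub2.
(* Second block: the pivot alone, one vote behind each [a_i]. Its ballots name nobody else but
   eliminated [c_i]. *)
apply: (@decided_eliminations _ q n.+1 0 [set star n] (side n true) _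
  (base n).+1%:R [set pivot n] pl2 [::]) => //.
- by rewrite cards1.
- by rewrite cards1 card_side.
- by rewrite disjoint_sym disjoints1 mem_side.
- by rewrite hop2 setUC.
- by move=> y; rewrite inE => /eqP->; rewrite tally2 ?inE ?eqxx // tallyS ler0n.
- case=> [[] [i|]]; rewrite mulr0n addr0 !(inE, mem_side) //= => _.
    by rewrite tally2 ?inE ?mem_side ?orbT // tallyE //= addr0 ltr_nat.
  rewrite tally2 ?inE ?mem_side ?orbT // tallyE //= -natrD ltr_nat; lia.
- move=> y; rewrite inE => /eqP->; rewrite tally2 ?inE ?eqxx ?orbT // tallyE //=.
  by rewrite -natrD ler_nat addn2 prednK ?base_gt0.
- case=> [[] [i|]]; rewrite mulr0n addr0 mem_side //= => _.
  by rewrite tally2 ?inE ?mem_side ?orbT // tallyE //= addr0 ltr_nat.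
- move=> wb x /sub2[->|wbpl]; rewrite // inE => /eqP-> hd.
  have : ohead wb.2 != Some (star n) by rewrite hd.
  by case/(pl_cases _ wbpl) => [E|[i [] E]]; rewrite E /= in hd *;
    rewrite // !inE mem_side.
by move=> pl3 b3 st3 el3 hop3 *; apply: decided_final.
Qed.

(** * The count with the added ballots *)

Lemma ohead_ranking (n : nat) : (0 < n)%N ->
  exists i, ohead (ranking n) = Some (true, Some i).
Proof. by case: n => // n _; exists ord0; rewrite /ranking enum_ordSl. Qed.

Lemma decided_with (n : nat) : (0 < n)%N ->
  let P' := prof n ++ nseq (2 * n.+2) (ranking n) in
  decided (quota P' n.+1) n.+1 (star n |: side n false) (init P').
Proof.
move=> n0 P'; have [i0 head_b] := ohead_ranking n0.
(* The quota has risen to the star's own total, which leaves no surplus. *)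
have qE : quota P' n.+1 = star_votes n.
  by rewrite quota_prof -addn3 -addnA.
(* A share outweighs the lead of the [a_i] over the [c_i] together with the whole bundle. *)
have gap : ((base n).+2 + 2 * n.+2 < base n + share n)%N.
  by rewrite /share; lia.
(* Even a [c_i] with its share and the bundle stays below quota. *)
have qlt : (base n + share n + 2 * n.+2 < star_votes n)%N.
  by rewrite /base /star_votes /share; nia.
rewrite qE {qE} /P'; move: (2 * n.+2)%N gap qlt => k gap qlt.
apply: decided_star => //; first by rewrite head_b.
  by lia.
set st := star_elected _.
have votesE y : votes st y =
    (first_votes y + (if ohead (ranking n) == Some y then k else 0))%:R.
  by rewrite natrD -tally_prof -tally_nseq -tally_cat.
apply: decided_eliminate.
- exact: star_nonstop.
- apply/setP => y; rewrite in_set0 inE hopeful_star_elected votesE !inE ler_nat.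
  by apply/negbTE/negP => /andP[/first_votes_le]; case: ifP; lia.
- apply/setP => y; rewrite !inE; have [->|//] := eqVneq y (star n).
  by rewrite votesE head_b /= addn0 ltxx.
- by apply/set0Pn; exists (pivot n); rewrite hopeful_star_elected !inE.
move=> x; rewrite hopeful_star_elected !inE => xstar xmin.
(* The pivot, with [base n - 1], is strictly last: the bundle lies with an [a_i] and only raises
   that total. *)
have {xmin xstar} -> : x = pivot n.
  have := xmin (pivot n); rewrite !inE !votesE head_b => /(_ isT) /=.
  rewrite ler_nat addn0 => /(leq_trans (leq_addr _ _)); have := base_gt0 n.
  by case: x xstar {xmin} => [[] [i|]] //= _; lia.
set H := hopeful st :\ pivot n.
have HE : H = side n false :|: side n true.
  by apply/setP => -[[] [i|]]; rewrite /H hopeful_star_elected !(inE, mem_side).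
set pl := [seq pass_on H 1 (pivot n) wb | wb <- ones n].
(* The pivot's ballots have different fates: a share goes to each [c_i] and the spare ones are
   exhausted. All have weight 1, so the gain is a count over the profile. *)
have tallyE y : y != pivot n -> tally pl y =
    (first_votes y + if y \in side n false then share n else 0)%:R.
  move=> yp; rewrite tally_pass_on // tally_prof mul1r natrD; congr (_ + _).
  transitivity ((count (fun b => (ohead b == Some (pivot n)) &&
    (ohead [seq c <- behead b | c \in H] == Some y)) (prof n))%:R : rat).
    by rewrite big_map -sum1_count natr_sum.
  congr (_%:R); rewrite count_prof HE /= !mul0n add0n.
  under eq_bigr => i _ do rewrite !inE !mem_side /=.
  rewrite add0n; case: y yp => [[] [i|]] //= _; rewrite mem_side /=.
  - by rewrite big1.
  - by rewrite big1.
  under eq_bigr => j _ do rewrite !addn0 (_ : (Some _ == Some _) = (j == i)) //.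
  by rewrite sum_eq_ord.
have pl_true wb i : wb \in pl -> ohead wb.2 = Some (true, Some i) ->
    behead wb.2 = [::].
  case/mapP => wb0 /mapP[b /prof_cases[->|->|[j [] ->]] ->] -> //=;
    rewrite /pass_on //= !inE ?mem_side //=.
(* The [a_i] have [base n + 2] votes besides the bundle, the [c_i] have [base n + share n]. The
   [a_i] may go in any order, with the bundle moving among them. *)
apply: (@decided_eliminations _ (star_votes n) n.+1 k [set star n]
  (side n false) _ (base n).+2%:R (side n true) pl (ranking n) (eliminate st (pivot n))) => //.
- by rewrite cards1.
- by rewrite cards1 card_side.
- rewrite disjoint_subset; apply/subsetP => -[[] [i|]];
    by rewrite !(inE, mem_side).
- by rewrite hopeful_eliminate -/H HE.
- rewrite /= map_cat map_nseq; congr (_ ++ nseq _ _).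
  by rewrite /pass_on /= head_b.
- by move=> y; rewrite inE => /eqP->; rewrite head_b.
- by move=> y; rewrite inE => /eqP->; rewrite tallyE // mem_side /= addn0.
- case=> [[] [i|]]; rewrite !(inE, mem_side) //= => _;
    rewrite tallyE // mem_side /= -natrD ltr_nat; lia.
- case=> [[] [i|]]; rewrite mem_side //= => _.
  by rewrite tallyE // mem_side /= addn0.
- case=> [[] [i|]]; rewrite mem_side //= => _.
  by rewrite tallyE // mem_side /= -natrD ltr_nat; lia.
- move=> wb [[] [i|]] wbpl; rewrite mem_side //= => _ /(pl_true _ _ wbpl)->.
  by [].
by move=> pl3 b3 st3 el3 hop3 *; apply: decided_final.
Qed.

End Counts.

Theorem proposition2 (S : nat) (hS : 1 < S) :
  exists (C : finType) (P : profile C) (b : seq C) (k : nat) (W W' : {set C}),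
    [/\ is_profile P, ranks_all b & 0 < k] /\
    stv_winners P S W /\
    stv_winners (P ++ nseq k b) S W' /\
    W = [set c in take S b] /\
    (#|W :&: W'| = 1 /\ (forall c : C, c \in take (S - 1) b -> c \notin W')) /\
    (forall c : C, c \in drop (size b - (S - 1)) b -> c \in W').
Proof.
case: S hS => // n; rewrite ltnS => n0.
exists (cand n), (prof n), (ranking n), (2 * n.+2).
exists (star n |: side n true), (star n |: side n false).
have size_top t : size [seq (t, Some i) : cand n | i <- enum 'I_n] = n.
  by rewrite size_map size_enum_ord.
split; first by split; [exact: prof_is_profile | exact: ranking_ranks_all |].
split; first exact: decided_run (decided_without n0).
split; first exact: decided_run (decided_with n0).
rewrite subn1 /ranking; split; [|split; [split|]].
(* The top [n.+1] positions hold the [a_i] and then the star. *)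
- apply/setP => y; rewrite inE take_cat size_top ltnNge leqnSn /= subSnn.
  by rewrite mem_cat /= mem_ranking_side !inE orbC.
- rewrite (_ : _ :&: _ = [set star n]) ?cards1 //.
  by apply/setP => -[[] [i|]]; rewrite !(inE, mem_side).
- move=> c; rewrite take_size_cat // mem_ranking_side mem_side.
  by case: c => [[] [i|]] //= _; rewrite !(inE, mem_side).
move=> c; rewrite size_cat /= !size_top.
(* Skipping [n + 2] entries passes the [a_i], the star and the pivot. *)
rewrite (_ : n + _ - n = (n + 2)%N); last by lia.
rewrite drop_cat size_top ltnNge leq_addr /= addKn /= drop0 mem_ranking_side.
by move=> cF; rewrite inE cF orbT.
Qed.
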